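(* Consider the DC/AC converter $$C_{dc}\dot v_{dc}=-G_{dc}v_{dc}+i_{dc}-\tfrac12 m_{\alpha\beta}^\top i_{\alpha\beta},\qquad C\,\dot v_{\alpha\beta}=-i_{load}+i_{\alpha\beta},\qquad L\,\dot i_{\alpha\beta}=-R\,i_{\alpha\beta}+\tfrac12 m_{\alpha\beta}v_{dc}-v_{\alpha\beta}$$ together with the controller $\dot\theta_v=\omega_v=\eta v_{dc}$, $m_{\alpha\beta}=\mu\begin{bmatrix}-\sin\theta_v\\ \cos\theta_v\end{bmatrix}$. Assume that all DC and AC signals are in steady state with synchronous frequency $\omega_s$. Let $P_x$ denote the active power flowing out of the average switching voltage node $v_x=\tfrac12 m_{\alpha\beta}v_{dc}$, and let $\hat v_x$ and $\omega_x$ be the amplitude and frequency of $v_x$. Then $$\hat v_x=\frac{\mu}{4G_{dc}}\Big(i_{dc}+\sqrt{i_{dc}^2-4G_{dc}P_x}\Big),\qquad \omega_x=\frac{\eta}{2G_{dc}}\Big(i_{dc}+\sqrt{i_{dc}^2-4G_{dc}P_x}\Big),$$ with $\omega_x=\omega_v=\omega_s$ by assumption. Moreover, there is no influence of the reactive power $Q_x$ on the amplitude and frequency $(\hat v_x,\omega_x)$.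
   Context: $v_{dc}(t)\in\mathbb R$ is the DC capacitor voltage; $v_{\alpha\beta}(t),i_{\alpha\beta}(t),i_{load}(t)\in\mathbb R^2$ are the AC capacitor voltage, the inductor current and the load current; $m_{\alpha\beta}(t)\in\mathbb R^2$ is the modulation signal and $\theta_v$ the controller angle. The constants $C_{dc},G_{dc},C,L,R,\eta,i_{dc}$ are positive, $\mu\in(0,1]$, and $J_2=\begin{bmatrix}0&-1\\1&0\end{bmatrix}$. An AC signal $z_{\alpha\beta}(t)\in\mathbb R^2$ is in (synchronous and balanced) steady state if $\dot z_{\alpha\beta}=\omega_sJ_2z_{\alpha\beta}$ for some nonzero synchronous frequency $\omega_s\in\mathbb R$; a DC signal $z_{dc}(t)\in\mathbb R$ is in steady state if $\dot z_{dc}=0$. It is assumed that a non-trivial steady state exists for all DC and AC signals. The active and reactive power flowing out of the node $v_x$ are $P_x=v_x^\top i_{\alpha\beta}$ and $Q_x=v_x^\top J_2\,i_{\alpha\beta}$. The amplitude of an AC signal written as $\hat v\,(-\sin\theta,\cos\theta)^\top$ is $\hat v$, and its frequency is $\dot\theta$.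
   Formalization: The formulas for the amplitude and frequency of v_x, and the claim of no influence of Q_x, are proved under the added condition v_dc ≥ i_dc/(2G_dc), which selects the ''+'' root; steady states on the other root exist and violate the formulas. *)

(* Defs.v *)
From HB Require Import structures.
From mathcomp Require Import all_boot all_order all_algebra.
From mathcomp Require Import all_classical all_reals all_analysis.

Set Implicit Arguments.
Unset Strict Implicit.
Unset Printing Implicit Defensive.

Import Order.TTheory GRing.Theory Num.Theory.
Import numFieldNormedType.Exports.
Local Open Scope ring_scope.

Section Plane.
Variable R : realType.

Definition vec2 (a b : R) : 'cV[R]_2 := \col_(i < 2) (if i == 0 then a else b).

(* J2 = [0 -1; 1 0] *)
Definition J2 : 'M[R]_2 := delta_mx 1 0 - delta_mx 0 1.

Definition dot2 (u v : 'cV[R]_2) : R := (u^T *m v) 0 0.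

Definition sincos (a : R) : 'cV[R]_2 := vec2 (- sin a) (cos a).

(* The [derivable] conjuncts here and below are needed because [derive1] is a
   total operator with a junk value at points of non-differentiability. *)
Definition ac_steady (ws : R) (z : R -> 'cV[R]_2) : Prop :=
  forall t, derivable z t 1 /\ derive1 z t = ws *: (J2 *m z t).

Definition dc_steady (z : R -> R) : Prop :=
  forall t, derivable z t 1 /\ derive1 z t = 0.

(* [z] is written as [a (-sin th, cos th)]: its amplitude is [a] and its
   frequency is [derive1 th].  Without [0 <= a] the amplitude would only be
   determined up to sign, since [a] can be replaced by [- a] when [th] is
   shifted by [pi]. *)
Definition amplitude_angle (z : R -> 'cV[R]_2) (a : R) (th : R -> R) : Prop :=
  0 <= a /\ forall t, derivable th t 1 /\ z t = a *: sincos (th t).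

End Plane.

Arguments J2 {R}.

Record converter (R : realType) := Converter {
  C_dc : R; G_dc : R;    (* DC capacitance and conductance *)
  C_ac : R;              (* AC filter capacitance *)
  L_ac : R; R_ac : R;    (* AC filter inductance and resistance *)
  i_dc : R;              (* constant DC source current *)
  eta_v : R; mu_v : R        (* controller gain and modulation amplitude *)
}.

Record signals (R : realType) := Signals {
  v_dc : R -> R;
  v_ab : R -> 'cV[R]_2;
  i_ab : R -> 'cV[R]_2;
  i_load : R -> 'cV[R]_2;
  theta_v : R -> R
}.

Section Converter.
Variables (R : realType) (p : converter R).

Definition admissible : Prop :=
  [/\ [/\ 0 < C_dc p, 0 < G_dc p & 0 < C_ac p],
      [/\ 0 < L_ac p, 0 < R_ac p & 0 < i_dc p],
      0 < eta_v p
    & 0 < mu_v p <= 1].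

Variable s : signals R.

Definition m_ab (t : R) : 'cV[R]_2 := mu_v p *: sincos (theta_v s t).

Definition omega_v (t : R) : R := eta_v p * v_dc s t.

Definition closed_loop : Prop := forall t,
  [/\ derivable (v_dc s) t 1 /\
        C_dc p * derive1 (v_dc s) t =
          - G_dc p * v_dc s t + i_dc p - 2^-1 * dot2 (m_ab t) (i_ab s t),
      derivable (v_ab s) t 1 /\
        C_ac p *: derive1 (v_ab s) t = - i_load s t + i_ab s t,
      derivable (i_ab s) t 1 /\
        L_ac p *: derive1 (i_ab s) t =
          - (R_ac p *: i_ab s t) + (2^-1 * v_dc s t) *: m_ab t - v_ab s t
    & derivable (theta_v s) t 1 /\ derive1 (theta_v s) t = omega_v t].

(* All DC and AC signals are in steady state with the same, nonzero,
   synchronous frequency. *)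
Definition in_steady_state (ws : R) : Prop :=
  [/\ ws != 0,
      dc_steady (v_dc s),
      ac_steady ws (v_ab s) /\ ac_steady ws (i_ab s)
    & ac_steady ws (i_load s) /\ ac_steady ws m_ab].

Definition v_x (t : R) : 'cV[R]_2 := (2^-1 * v_dc s t) *: m_ab t.

Definition P_x (t : R) : R := dot2 (v_x t) (i_ab s t).

Definition Q_x (t : R) : R := dot2 (v_x t) (J2 *m i_ab s t).

(* In steady state the DC equation times [v_dc] reads
   [G_dc v_dc^2 - i_dc v_dc + P_x = 0].  When its discriminant is positive and
   [0 < P_x] both roots are positive and both occur in steady states.  This
   predicate selects the larger root, i.e. the one taken with [+ sqrt]. *)
Definition high_voltage_branch : Prop :=
  forall t, i_dc p / (2 * G_dc p) <= v_dc s t.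

End Converter.

(* Main.v *)
Require Import Defs.
From HB Require Import structures.
From mathcomp Require Import all_boot all_order all_algebra.
From mathcomp Require Import all_classical all_reals all_analysis.
From mathcomp Require Import ring.
Import Order.TTheory GRing.Theory Num.Theory.
Import numFieldNormedType.Exports.
Local Open Scope ring_scope.

(** In steady state the DC voltage is a constant [V], so [v_x] is a constant
    multiple of the modulation signal [m_ab] and rotates like it.  A signal
    [a (-sin th, cos th)] has derivative [th' J2 z]; if it is also steady at
    the frequency [ws] and does not vanish, comparison gives [th' = ws]
    ([steady_frequency]).  For [m_ab] this says [eta V = ws].  In particular
    [V <> 0] because [ws <> 0], so [v_x] does not vanish either and every
    angle that represents it has the derivative [ws] as well.  Its amplitude
    is [mu |V| / 2], by comparison of norms ([sqr_amplitude]).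

    It remains to find [V].  The DC equation with a vanishing left-hand side,
    multiplied by [V], is [G_dc V^2 - i_dc V + P_x = 0] ([power_balance]),
    whose discriminant is the square [(2 G_dc V - i_dc)^2]; on the
    high-voltage branch the quantity being squared is nonnegative, so it is
    the square root of the discriminant ([v_dc_high_branch]).  The resulting
    formulas contain the power flow only through [P_x], which is why two
    steady states that differ in [Q_x] alone have the same amplitude and the
    same frequency. *)

(** * Rotating signals in the plane *)

Lemma J2_vec2 (R : realType) (a b : R) : J2 *m vec2 a b = vec2 (- b) a.
Proof.
apply/matrixP => i j; rewrite !mxE !big_ord_recl big_ord0 !mxE /= {j}.
by case: i => [[|[|//]] hi] /=; ring.
Qed.

Lemma scale_vec2 (R : realType) (k a b : R) :
  k *: vec2 a b = vec2 (k * a) (k * b).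
Proof. by apply/matrixP => i j; rewrite !mxE; case: ifP. Qed.

Lemma vec2_inj (R : realType) (a b c d : R) :
  vec2 a b = vec2 c d -> a = c /\ b = d.
Proof.
by move=> /matrixP e; have := e 0 0; have := e 1 0; rewrite !mxE /= => -> ->.
Qed.

Lemma dot2Zl (R : realType) (k : R) (u v : 'cV[R]_2) :
  dot2 (k *: u) v = k * dot2 u v.
Proof. by rewrite /dot2 linearZ /= -scalemxAl mxE. Qed.

(** Comparison of the Euclidean norms of two polar representations of the
    same vector; the sign of the amplitude is not determined, since it can be
    absorbed in the angle. *)
Lemma sqr_amplitude (R : realType) (a b x y : R) :
  a *: sincos x = b *: sincos y -> a ^+ 2 = b ^+ 2.
Proof.
rewrite /sincos !scale_vec2 => /vec2_inj [e1 e2].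
have -> : a ^+ 2 = (a * - sin x) ^+ 2 + (a * cos x) ^+ 2.
  by rewrite -[LHS]mulr1 -(cos2Dsin2 x); ring.
by rewrite e1 e2 -[RHS]mulr1 -(cos2Dsin2 y); ring.
Qed.

(** Differentiation turns [(-sin, cos)] into [(-cos, -sin)], which is a
    quarter-turn, hence the factor [J2]. *)
Lemma derive1_rotating (R : realType) (a : R) (th : R -> R) (t : R) :
  derivable th t 1 ->
  derive1 (fun u => a *: sincos (th u)) t =
    derive1 th t *: (J2 *m (a *: sincos (th t))).
Proof.
move=> dth.
have hth : is_derive t 1 th (derive1 th t) by rewrite derive1E; exact: derivableP.
have hcos : is_derive t (1 : R) (fun u => cos (th u))
    (- sin (th t) * derive1 th t).
  by apply: (@is_derive1_comp _ cos th).
have hsin : is_derive t (1 : R) (fun u => sin (th u))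
    (cos (th t) * derive1 th t).
  by apply: (@is_derive1_comp _ sin th).
have h0 : is_derive t (1 : R) (fun u => a * - sin (th u))
    (a * - (cos (th t) * derive1 th t)) by apply: is_deriveZ.
have h1 : is_derive t (1 : R) (fun u => a * cos (th u))
    (a * (- sin (th t) * derive1 th t)) by apply: is_deriveZ.
have coord (i : 'I_2) (j : 'I_1) :
    is_derive t (1 : R) (fun u => (a *: sincos (th u)) i j)
      ((derive1 th t *: (J2 *m (a *: sincos (th t)))) i j).
  rewrite /sincos scale_vec2 J2_vec2 scale_vec2 mxE.
  under eq_fun do rewrite scale_vec2 mxE.
  case: ifP => _.
    by have -> : derive1 th t * - (a * cos (th t)) =
      a * - (cos (th t) * derive1 th t) by ring.
  by have -> : derive1 th t * (a * - sin (th t)) =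
    a * (- sin (th t) * derive1 th t) by ring.
rewrite derive1E derive_mx.
  by apply/matrixP => i j; rewrite mxE; have [_ ->] := coord i j.
by apply/derivable_mxP => i j; have [] := coord i j.
Qed.

(** Both [th' J2 z] and [w J2 z] are the derivative of [z], and [J2 z] does
    not vanish when [a] is nonzero. *)
Lemma steady_frequency (R : realType) (w a : R) (z : R -> 'cV[R]_2)
    (th : R -> R) :
  ac_steady w z -> amplitude_angle z a th -> a != 0 ->
  forall t, derive1 th t = w.
Proof.
move=> zst [_ zth] a0 t.
have [dth zt] := zth t; have [_ dz] := zst t.
have zE : z = fun u => a *: sincos (th u) by apply/funext => u; have [] := zth u.
move: dz; rewrite [in LHS]zE derive1_rotating // zt.
rewrite /sincos !scale_vec2 J2_vec2 !scale_vec2 => /vec2_inj [e1 e2].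
(* The two coordinates involve [cos] and [sin], which have no common zero. *)
have e : (derive1 th t - w) * a = 0.
  rewrite -[LHS]mulr1 -(cos2Dsin2 (th t)).
  have -> : (derive1 th t - w) * a * (cos (th t) ^+ 2 + sin (th t) ^+ 2) =
    - cos (th t) * (derive1 th t * - (a * cos (th t)) - w * - (a * cos (th t)))
    - sin (th t) * (derive1 th t * (a * - sin (th t)) - w * (a * - sin (th t)))
    by ring.
  by rewrite e1 e2 !subrr !mulr0 subrr.
by move/eqP: e; rewrite mulf_eq0 (negbTE a0) orbF subr_eq0 => /eqP.
Qed.

Lemma ac_steadyZ (R : realType) (w k : R) (z : R -> 'cV[R]_2) :
  ac_steady w z -> ac_steady w (fun t => k *: z t).
Proof.
move=> zst t; have [dz ez] := zst t; split; first exact: derivableZ.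
by rewrite derive1E deriveZ // -derive1E ez -scalemxAr !scalerA mulrC.
Qed.

Lemma dc_steady_cst (R : realType) (z : R -> R) :
  dc_steady z -> forall t u, z t = z u.
Proof.
move=> zst t u; apply: is_derive_0_is_cst => x.
by have [dz <-] := zst x; rewrite derive1E; apply: derivableP.
Qed.

(** When [k] is negative, a half-turn of the angle reverses its sign. *)
Lemma amplitude_angle_exists (R : realType) (k : R) (th : R -> R) :
  (forall t, derivable th t 1) ->
  exists (a : R) (thx : R -> R),
    amplitude_angle (fun t => k *: sincos (th t)) a thx.
Proof.
move=> dth; have [k0|k0] := leP 0 k.
  by exists k, th; split.
exists (- k), (fun t => th t + pi); split; first by rewrite oppr_ge0 ltW.
move=> t; split; first by apply: derivableD => //; exact: derivable_cst.
rewrite /sincos sinDpi cosDpi !scale_vec2.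
by congr vec2; ring.
Qed.

(** * Steady states of the converter *)

Section SteadyState.
Variables (R : realType) (p : converter R) (s : signals R) (ws : R).
Hypotheses (hp : admissible p) (hcl : closed_loop p s).
Hypothesis hst : in_steady_state p s ws.

Lemma v_xE (t : R) :
  v_x p s = fun u => (2^-1 * v_dc s t * mu_v p) *: sincos (theta_v s u).
Proof.
have [_ vst _ _] := hst.
by apply/funext => u; rewrite /v_x /m_ab scalerA (dc_steady_cst _ _ vst u t).
Qed.

Lemma ac_steady_v_x : ac_steady ws (v_x p s).
Proof.
have [_ vst _ [_ mst]] := hst.
have -> : v_x p s = fun u => (2^-1 * v_dc s 0) *: m_ab p s u.
  by apply/funext => u; rewrite /v_x (dc_steady_cst _ _ vst u 0).
exact: ac_steadyZ.
Qed.

Lemma omega_v_steady (t : R) : omega_v p s t = ws.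
Proof.
have [_ _ _ /andP[mu0 _]] := hp; have [_ _ _ [_ mst]] := hst.
have [_ _ _ [_ <-]] := hcl t.
apply: (steady_frequency _ _ _ _ _ mst) (lt0r_neq0 mu0) t.
by split=> [|u]; [exact: ltW|have [_ _ _ []] := hcl u].
Qed.

(** A vanishing DC voltage would freeze the controller angle, against
    [ws <> 0]; a negative one is possible when [P_x < 0]. *)
Lemma v_dc_neq0 (t : R) : v_dc s t != 0.
Proof.
have [ws0 _ _ _] := hst; apply: contraNneq ws0 => v0.
by rewrite -(omega_v_steady t) /omega_v v0 mulr0.
Qed.

(** The DC equation times [v_dc]: the converter draws from the DC side exactly
    the power that flows out of the switching node. *)
Lemma power_balance (t : R) :
  G_dc p * v_dc s t ^+ 2 - i_dc p * v_dc s t + P_x p s t = 0.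
Proof.
have [_ vst _ _] := hst; have [_ dv] := vst t.
have [[_ e] _ _ _] := hcl t; move: e; rewrite dv mulr0 => /esym e.
rewrite /P_x /v_x dot2Zl.
transitivity (- v_dc s t * (- G_dc p * v_dc s t + i_dc p
  - 2^-1 * dot2 (m_ab p s t) (i_ab s t))); first by ring.
by rewrite e mulr0.
Qed.

Lemma discriminantE (t : R) :
  i_dc p ^+ 2 - 4 * G_dc p * P_x p s t = (2 * G_dc p * v_dc s t - i_dc p) ^+ 2.
Proof.
apply/eqP; rewrite -subr_eq0 -[X in _ == X](mulr0 (- 4 * G_dc p)).
by rewrite -(power_balance t); apply/eqP; ring.
Qed.

(** The branch condition says that [2 G_dc v_dc - i_dc] is nonnegative, so it
    is the principal root of the discriminant. *)
Lemma v_dc_high_branch (t : R) : high_voltage_branch p s ->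
  i_dc p + Num.sqrt (i_dc p ^+ 2 - 4 * G_dc p * P_x p s t) =
    2 * G_dc p * v_dc s t.
Proof.
have [[_ G0 _] _ _ _] := hp => /(_ t).
rewrite ler_pdivrMr ?mulr_gt0// mulrC => hb.
by rewrite discriminantE sqrtr_sqr ger0_norm ?subr_ge0 // addrC subrK.
Qed.

Lemma v_x_frequency (a : R) (th : R -> R) :
  amplitude_angle (v_x p s) a th -> forall t, derive1 th t = ws.
Proof.
move=> h; apply: (steady_frequency _ _ _ _ _ ac_steady_v_x h).
have [_ _ _ /andP[mu0 _]] := hp; have [_ /(_ 0)[_]] := h.
rewrite (v_xE 0) => /sqr_amplitude e.
by rewrite -sqrf_eq0 -e sqrf_eq0 !mulf_neq0 ?v_dc_neq0 ?lt0r_neq0 ?invr_gt0.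
Qed.

Lemma v_x_amplitude (a : R) (th : R -> R) (t : R) :
  amplitude_angle (v_x p s) a th -> a = 2^-1 * mu_v p * `|v_dc s t|.
Proof.
have [_ _ _ /andP[mu0 _]] := hp; move=> [a0 /(_ t)[_]].
rewrite (v_xE t) => /sqr_amplitude e.
rewrite -[a]ger0_norm // -sqrtr_sqr -e sqrtr_sqr !normrM.
by rewrite (gtr0_norm mu0) gtr0_norm ?invr_gt0 //; ring.
Qed.

Lemma high_branch_formulas (a : R) (th : R -> R) (t : R) :
  high_voltage_branch p s -> amplitude_angle (v_x p s) a th ->
  a = mu_v p / (4 * G_dc p) *
    (i_dc p + Num.sqrt (i_dc p ^+ 2 - 4 * G_dc p * P_x p s t)) /\
  derive1 th t = eta_v p / (2 * G_dc p) *
    (i_dc p + Num.sqrt (i_dc p ^+ 2 - 4 * G_dc p * P_x p s t)).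
Proof.
have [[_ G0 _] [_ _ i0] _ _] := hp => hb h; have Gn0 := lt0r_neq0 G0.
have v0 : 0 <= v_dc s t.
  by apply: le_trans (hb t); rewrite divr_ge0 ?mulr_ge0 ?ltW.
rewrite v_dc_high_branch // (v_x_amplitude _ _ t h) (v_x_frequency _ _ h).
by rewrite -(omega_v_steady t) /omega_v ger0_norm //; split; field.
Qed.

End SteadyState.

Theorem theorem5p2p3 (R : realType) (p : converter R) (hp : admissible p) :
  (forall (s : signals R) (ws : R),
     closed_loop p s -> in_steady_state p s ws ->
     (exists (vx_hat : R) (theta_x : R -> R),
        amplitude_angle (v_x p s) vx_hat theta_x) /\
     (forall (vx_hat : R) (theta_x : R -> R),
        amplitude_angle (v_x p s) vx_hat theta_x ->
        forall t : R,
          derive1 theta_x t = omega_v p s t /\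
          omega_v p s t = ws /\
          0 <= i_dc p ^+ 2 - 4 * G_dc p * P_x p s t /\
          (high_voltage_branch p s ->
           vx_hat = mu_v p / (4 * G_dc p) *
             (i_dc p + Num.sqrt (i_dc p ^+ 2 - 4 * G_dc p * P_x p s t)) /\
           derive1 theta_x t = eta_v p / (2 * G_dc p) *
             (i_dc p + Num.sqrt (i_dc p ^+ 2 - 4 * G_dc p * P_x p s t))))) /\
  (forall (s1 s2 : signals R) (ws1 ws2 P Q1 Q2 : R),
     closed_loop p s1 -> in_steady_state p s1 ws1 -> high_voltage_branch p s1 ->
     closed_loop p s2 -> in_steady_state p s2 ws2 -> high_voltage_branch p s2 ->
     (forall t : R, P_x p s1 t = P /\ Q_x p s1 t = Q1) ->
     (forall t : R, P_x p s2 t = P /\ Q_x p s2 t = Q2) ->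
     forall (vx_hat1 vx_hat2 : R) (theta_x1 theta_x2 : R -> R),
       amplitude_angle (v_x p s1) vx_hat1 theta_x1 ->
       amplitude_angle (v_x p s2) vx_hat2 theta_x2 ->
       vx_hat1 = vx_hat2 /\
       (forall t : R, derive1 theta_x1 t = derive1 theta_x2 t)).
Proof.
split=> [s ws hcl hst|s1 s2 ws1 ws2 P Q1 Q2 cl1 st1 hb1 cl2 st2 hb2 PQ1 PQ2].
  split=> [|a th h t].
    rewrite (v_xE _ _ _ _ hst 0); apply: amplitude_angle_exists => t.
    by have [_ _ _ []] := hcl t.
  rewrite (omega_v_steady _ _ _ _ hp hcl hst).
  rewrite {1}(v_x_frequency _ _ _ _ hp hcl hst _ _ h).
  rewrite {1}(discriminantE _ _ _ _ hcl hst) sqr_ge0.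
  by do 3![split=> //] => hb; apply: high_branch_formulas hst _ _ _ hb h.
move=> a1 a2 th1 th2 h1 h2.
have f1 t := high_branch_formulas _ _ _ _ hp cl1 st1 _ _ t hb1 h1.
have f2 t := high_branch_formulas _ _ _ _ hp cl2 st2 _ _ t hb2 h2.
split=> [|t].
  by rewrite (f1 0).1 (f2 0).1 (PQ1 0).1 (PQ2 0).1.
by rewrite (f1 t).2 (f2 t).2 (PQ1 t).1 (PQ2 t).1.
Qed.
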